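(* Let $S\subseteq \mathbb{N}$ with $0\in S$ and $|S|\geq 2$, and put $m_1(S)=\min(S\setminus\{0\})$ and $m_2(S)=\max S$ (with $m_2(S)=\infty$ if $S$ is unbounded). Then there exists a continuous function $f:[0,1]\to\mathbb{R}$ with $\Omega_f=S$ if and only if $m_2(S)\geq 2m_1(S)-1$.
   Context: $\mathbb{N}=\{0,1,2,\dots\}$. For a continuous $f:[0,1]\to\mathbb{R}$, $\Omega_f=\{n\in\mathbb{N}\cup\{\infty\} : \exists x\in\mathbb{R}\text{ with } |f^{-1}(x)|=n\}$, where $|f^{-1}(x)|$ is the cardinality of the preimage $\{t\in[0,1]: f(t)=x\}$ and $\infty$ stands for an infinite cardinality. In particular, $\Omega_f=S\subseteq\mathbb{N}$ forces every preimage to be finite. The maximum of an unbounded subset of $\mathbb{N}$ is taken to be $\infty$, and the inequality $\infty\geq 2m_1-1$ is considered true. *)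

(* Defs.v *)
From Stdlib Require Import Reals Lra Lia List.
Open Scope R_scope.

(* f : [0,1] -> R is represented by f : R -> R whose values outside [0,1]
   are irrelevant; continuity is continuity of the restriction to [0,1]. *)
Definition cont_on_01 (f : R -> R) : Prop :=
  forall t, 0 <= t <= 1 ->
    forall eps, 0 < eps -> exists delta, 0 < delta /\
      forall s, 0 <= s <= 1 -> Rabs (s - t) < delta -> Rabs (f s - f t) < eps.

Definition preim01 (f : R -> R) (x : R) : R -> Prop :=
  fun t => 0 <= t <= 1 /\ f t = x.

Definition has_card (P : R -> Prop) (n : nat) : Prop :=
  exists l : list R, NoDup l /\ length l = n /\ (forall t, In t l <-> P t).

Definition is_finite_set (P : R -> Prop) : Prop := exists n, has_card P n.

Definition Omega_eq (f : R -> R) (S : nat -> Prop) : Prop :=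
  (forall x, is_finite_set (preim01 f x)) /\
  (forall n, S n <-> exists x, has_card (preim01 f x) n).

Definition is_m1 (S : nat -> Prop) (m : nat) : Prop :=
  S m /\ m <> 0%nat /\ forall k, S k -> k <> 0%nat -> (m <= k)%nat.

Definition nat_bounded (S : nat -> Prop) : Prop := exists B, forall k, S k -> (k <= B)%nat.

(* m2(S) >= 2 m1(S) - 1, with m2 = infinity when S is unbounded *)
Definition m2_ge (S : nat -> Prop) : Prop :=
  forall m1, is_m1 S m1 ->
    ~ nat_bounded S \/
    exists M, S M /\ (forall k, S k -> (k <= M)%nat) /\ (2 * m1 - 1 <= M)%nat.

(* Main.v *)
Require Import Defs.
From Stdlib Require Import Reals ZArith Lra Lia List Sorting Permutation Classical IndefiniteDescription.
Open Scope R_scope.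

(** Necessity: after reversing the path or negating it, the maximum of [f], attained [n >= m1]
    times, is not attained at [1], and then a level just below it is met at least [2n - 1] times.

    Sufficiency: a zigzag of [2j + 1] monotone pieces meets both extreme levels [j + 1] times;
    stacking infinitely many zigzags that shrink towards an extreme level lowers its count to [1]
    without changing the counts in between, and each additional plain excursion adds [1] to the
    extreme counts and [2] in between.  So any extreme counts [p, q <= j + 1] occur with constant
    count [2j + 1] in between, and joining two such bands gives a level with any count [<= 2j + 1].
    If the largest count wanted is odd (or odd counts are unbounded) such a stack of bands is the
    required [f]; otherwise [f] runs 1/2 -> 1, down the stack 1 -> 0, and back 0 -> 1/2. *)

(** * Counting finite sets of reals *)

Definition card (f : R -> R) (x : R) (n : nat) : Prop := has_card (preim01 f x) n.

Lemma has_card_ext (P Q : R -> Prop) n :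
  (forall t, P t <-> Q t) -> has_card P n -> has_card Q n.
Proof.
  intros E (l & D & L & H). exists l. split; [easy|split; [easy|]].
  intros t. rewrite H. apply E.
Qed.

Lemma has_card_incl_length (P : R -> Prop) n l :
  has_card P n -> NoDup l -> (forall t, In t l -> P t) -> (length l <= n)%nat.
Proof.
  intros (l' & D & L & H) Dl Hl. subst n. apply NoDup_incl_length; [easy|].
  intros t Ht. apply H. auto.
Qed.

Lemma has_card_empty (P : R -> Prop) : (forall t, ~ P t) -> has_card P 0.
Proof.
  intros H. exists nil. split; [constructor|split; [easy|]].
  intros t. split; [easy|intros Ht; now apply (H t)].
Qed.

Lemma has_card_singleton (P : R -> Prop) a : (forall t, P t <-> t = a) -> has_card P 1.
Proof.
  intros H. exists (a :: nil). split; [|split; [easy|]].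
  - constructor; [easy|constructor].
  - intros t. rewrite H. simpl. split; [intros [E|[]]; auto|auto].
Qed.

Lemma has_card_nonempty (P : R -> Prop) n a : has_card P n -> P a -> n <> 0%nat.
Proof.
  intros (l & D & L & H) Ha E. subst n. destruct l; [|easy]. now apply H in Ha.
Qed.

Lemma has_card_unique (P : R -> Prop) n m : has_card P n -> has_card P m -> n = m.
Proof.
  intros (l & D & L & H) (l' & D' & L' & H'). subst.
  apply Nat.le_antisymm; apply NoDup_incl_length; trivial;
    intros t Ht; [apply H', H|apply H, H']; trivial.
Qed.

Lemma has_card_remove (P : R -> Prop) n a :
  has_card P n -> P a -> has_card (fun t => P t /\ t <> a) (n - 1).
Proof.
  intros (l & D & L & H) Ha. apply H in Ha.
  destruct (in_split _ _ Ha) as (l1 & l2 & E). subst l.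
  exists (l1 ++ l2). split; [|split].
  - now apply NoDup_remove_1 in D.
  - rewrite length_app in *. simpl in L. lia.
  - intros t. rewrite <- H. rewrite !in_app_iff. simpl. split.
    + intros Ht. split; [tauto|]. intros E. subst t.
      apply NoDup_remove_2 in D. apply D, in_app_iff, Ht.
    + intros [[|[|]] Hn]; auto. congruence.
Qed.

Lemma has_card_union (P Q : R -> Prop) n m :
  has_card P n -> has_card Q m -> (forall t, P t -> Q t -> False) ->
  has_card (fun t => P t \/ Q t) (n + m).
Proof.
  intros (l & D & L & H) (l' & D' & L' & H') HD.
  exists (l ++ l'). split; [|split].
  - apply NoDup_app; trivial. intros t Ht Ht'. apply (HD t); [now apply H|now apply H'].
  - rewrite length_app. lia.
  - intros t. rewrite in_app_iff, H, H'. tauto.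
Qed.

(** The shared point [a] is removed from [Q] before the disjoint union is taken. This is the count
    at a junction of two paths. *)
Lemma has_card_union_overlap (P Q : R -> Prop) n m a :
  has_card P n -> has_card Q m -> P a -> Q a -> (forall t, P t -> Q t -> t = a) ->
  has_card (fun t => P t \/ Q t) (n + m - 1).
Proof.
  intros HP HQ Pa Qa HD.
  assert (m <> 0%nat) by (eapply has_card_nonempty; eauto).
  replace (n + m - 1)%nat with (n + (m - 1))%nat by lia.
  apply has_card_ext with (fun t => P t \/ (Q t /\ t <> a)).
  - intros t. destruct (Req_dec t a) as [->|N]; tauto.
  - apply has_card_union; [easy|now apply has_card_remove|].
    intros t Pt [Qt N]. apply N. auto.
Qed.

Lemma has_card_image (P Q : R -> Prop) n (g h : R -> R) :
  has_card P n -> (forall t, P t -> Q (g t) /\ h (g t) = t) ->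
  (forall s, Q s -> P (h s) /\ g (h s) = s) -> has_card Q n.
Proof.
  intros (l & D & L & H) Hg Hh. exists (map g l). split; [|split].
  - apply NoDup_map_NoDup_ForallPairs; [|easy].
    intros a b Ha Hb E. apply H in Ha. apply H in Hb.
    destruct (Hg _ Ha) as [_ <-], (Hg _ Hb) as [_ <-]. now rewrite E.
  - now rewrite length_map.
  - intros s. rewrite in_map_iff. split.
    + intros (t & <- & Ht). apply H in Ht. now apply Hg.
    + intros Hs. destruct (Hh _ Hs) as [Ps E]. exists (h s). split; [easy|]. now apply H.
Qed.

(** * Retraction onto the unit interval and continuity *)

(** Composing with this retraction turns a function continuous on [0,1] into one continuous on the
    whole line, with the same values on [0,1]. *)
Definition clamp (t : R) : R := Rmax 0 (Rmin 1 t).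

Lemma clamp_id t : 0 <= t <= 1 -> clamp t = t.
Proof. intros. unfold clamp. rewrite Rmin_right, Rmax_right; lra. Qed.

Lemma clamp_low t : t <= 0 -> clamp t = 0.
Proof. intros. unfold clamp. rewrite Rmin_right, Rmax_left; lra. Qed.

Lemma clamp_high t : 1 <= t -> clamp t = 1.
Proof. intros. unfold clamp. rewrite Rmin_left, Rmax_right; lra. Qed.

Lemma clamp_range t : 0 <= clamp t <= 1.
Proof.
  unfold clamp. split; [apply Rmax_l|]. apply Rmax_lub; [lra|apply Rmin_l].
Qed.

Lemma clamp_lipschitz s t : Rabs (clamp s - clamp t) <= Rabs (s - t).
Proof.
  destruct (Rle_or_lt s 0), (Rle_or_lt t 0), (Rle_or_lt 1 s), (Rle_or_lt 1 t); try lra;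
  rewrite ?(clamp_low s), ?(clamp_low t), ?(clamp_high s), ?(clamp_high t),
    ?(clamp_id s), ?(clamp_id t) by lra; split_Rabs; lra.
Qed.

Lemma continuity_of_eps (f : R -> R) :
  (forall x eps, 0 < eps -> exists d, 0 < d /\
     forall y, Rabs (y - x) < d -> Rabs (f y - f x) < eps) -> continuity f.
Proof.
  intros H x eps He. destruct (H x eps He) as (d & Hd & Hy). exists d. split; [easy|].
  intros y [_ Hyd]. apply Hy, Hyd.
Qed.

Lemma continuity_pt_eps (f : R -> R) x : continuity_pt f x ->
  forall eps, 0 < eps -> exists d, 0 < d /\
     forall y, Rabs (y - x) < d -> Rabs (f y - f x) < eps.
Proof.
  intros H eps He. destruct (H eps He) as (d & Hd & Hy). exists d. split; [easy|].
  intros y Hyd. destruct (Req_dec y x) as [->|N].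
  - replace (f x - f x) with 0 by ring. now rewrite Rabs_R0.
  - apply Hy. split; [|easy]. split; [easy|congruence].
Qed.

Lemma continuity_clamp : continuity clamp.
Proof.
  apply continuity_of_eps. intros x eps He. exists eps. split; [easy|].
  intros y Hy. pose proof (clamp_lipschitz y x). lra.
Qed.

Lemma continuity_affine a b : continuity (fun t => a * t + b).
Proof. intros x. reg. Qed.

Lemma continuity_clamp_extension f : cont_on_01 f -> continuity (fun t => f (clamp t)).
Proof.
  intros H. apply continuity_of_eps. intros x eps He.
  destruct (H (clamp x) (clamp_range x) eps He) as (d & Hd & Hs).
  exists d. split; [easy|]. intros y Hy. apply Hs; [apply clamp_range|].
  pose proof (clamp_lipschitz y x). lra.
Qed.

Lemma continuity_cont_on_01 f : continuity f -> cont_on_01 f.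
Proof.
  intros H t Ht eps He. destruct (continuity_pt_eps f t (H t) eps He) as (d & Hd & Hs).
  exists d. split; auto.
Qed.

(** * Counts under reversal of the path and affine change of levels *)

Lemma card_clamp_extension f x n : card f x n <-> card (fun t => f (clamp t)) x n.
Proof.
  split; apply has_card_ext; intros t; unfold preim01;
    split; intros [Ht E]; rewrite clamp_id in *; auto.
Qed.

Lemma card_reverse f x n : card f x n -> card (fun t => f (1 - t)) x n.
Proof.
  intros H. apply (has_card_image _ _ _ (fun t => 1 - t) (fun t => 1 - t) H); unfold preim01;
  intros t [Ht E]; replace (1 - (1 - t)) with t by ring; repeat split; lra.
Qed.

Lemma card_scale f x n c d : c <> 0 -> card f x n -> card (fun t => c * f t + d) (c * x + d) n.
Proof.
  intros Hc. apply has_card_ext. intros t. unfold preim01. split.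
  - intros [Ht ->]. auto.
  - intros [Ht E]. split; [easy|]. apply Rmult_eq_reg_l with c; lra.
Qed.

Lemma card_scale' f x x' n c d :
  c <> 0 -> x' = c * x + d -> card f x n -> card (fun t => c * f t + d) x' n.
Proof. intros Hc ->. now apply card_scale. Qed.

Lemma card_avoid (f : R -> R) x : (forall t, 0 <= t <= 1 -> f t <> x) -> card f x 0.
Proof. intros H. apply has_card_empty. intros t [Ht E]. now apply (H t). Qed.

Lemma card_line a b x : a <> 0 -> 0 <= (x - b) / a <= 1 -> card (fun t => a * t + b) x 1.
Proof.
  intros Ha Hx. apply has_card_singleton with ((x - b) / a). intros t. unfold preim01. split.
  - intros [Ht <-]. field. easy.
  - intros ->. split; [easy|]. field. easy.
Qed.

(** * Concatenation of paths *)

(* Runs through [f] and then through [g], each at double speed; meaningful when [f 1 = g 0]. *)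
Definition conc (f g : R -> R) (t : R) : R := f (clamp (2 * t)) + g (clamp (2 * t - 1)) - f 1.

Lemma continuity_conc f g : continuity f -> continuity g -> continuity (conc f g).
Proof.
  intros Hf Hg. unfold conc. apply continuity_minus.
  - apply continuity_plus.
    + apply (continuity_comp (fun t => clamp (2 * t)) f); [|easy].
      apply (continuity_comp (fun t => 2 * t) clamp); [intros x; reg|apply continuity_clamp].
    + apply (continuity_comp (fun t => clamp (2 * t - 1)) g); [|easy].
      apply (continuity_comp (fun t => 2 * t - 1) clamp); [intros x; reg|apply continuity_clamp].
  - intros x. reg.
Qed.

Lemma conc_left f g t : f 1 = g 0 -> 0 <= t <= 1/2 -> conc f g t = f (2 * t).
Proof. intros E Ht. unfold conc. rewrite clamp_id, clamp_low by lra. lra. Qed.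

Lemma conc_right f g t : f 1 = g 0 -> 1/2 <= t <= 1 -> conc f g t = g (2 * t - 1).
Proof. intros E Ht. unfold conc. rewrite clamp_high, clamp_id by lra. lra. Qed.

Lemma conc_0 f g : f 1 = g 0 -> conc f g 0 = f 0.
Proof. intros E. rewrite conc_left by lra. f_equal; lra. Qed.

Lemma conc_1 f g : f 1 = g 0 -> conc f g 1 = g 1.
Proof. intros E. rewrite conc_right by lra. f_equal; lra. Qed.

Lemma conc_range f g (P : R -> Prop) : f 1 = g 0 ->
  (forall t, 0 <= t <= 1 -> P (f t)) -> (forall t, 0 <= t <= 1 -> P (g t)) ->
  forall t, 0 <= t <= 1 -> P (conc f g t).
Proof.
  intros E Hf Hg t Ht. destruct (Rle_or_lt t (1/2)).
  - rewrite conc_left by lra. apply Hf. lra.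
  - rewrite conc_right by lra. apply Hg. lra.
Qed.

Lemma conc_preimage f g x t : f 1 = g 0 ->
  ((0 <= t <= 1/2 /\ f (2 * t) = x) \/ (1/2 <= t <= 1 /\ g (2 * t - 1) = x))
  <-> preim01 (conc f g) x t.
Proof.
  intros E. unfold preim01. split.
  - intros [[Ht H]|[Ht H]]; (split; [lra|]).
    + now rewrite conc_left.
    + now rewrite conc_right.
  - intros [Ht H]. destruct (Rle_or_lt t (1/2)).
    + left. rewrite conc_left in H by lra. split; [lra|easy].
    + right. rewrite conc_right in H by lra. split; [lra|easy].
Qed.

Lemma has_card_left_half f x n :
  card f x n -> has_card (fun t => 0 <= t <= 1/2 /\ f (2 * t) = x) n.
Proof.
  intros H. apply (has_card_image _ _ _ (fun t => t / 2) (fun t => 2 * t) H); unfold preim01.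
  - intros t [Ht E]. replace (2 * (t / 2)) with t by field. repeat split; lra.
  - intros t [Ht E]. repeat split; try lra.
Qed.

Lemma has_card_right_half g x n :
  card g x n -> has_card (fun t => 1/2 <= t <= 1 /\ g (2 * t - 1) = x) n.
Proof.
  intros H. apply (has_card_image _ _ _ (fun t => (t + 1) / 2) (fun t => 2 * t - 1) H);
    unfold preim01.
  - intros t [Ht E]. replace (2 * ((t + 1) / 2) - 1) with t by field. repeat split; lra.
  - intros t [Ht E]. repeat split; try lra.
Qed.

(** The halves overlap only at [t = 1/2], whose level is [f 1]; at any other level the counts
    add. *)
Lemma card_conc_ne f g x n m : f 1 = g 0 -> x <> f 1 ->
  card f x n -> card g x m -> card (conc f g) x (n + m).
Proof.
  intros E Hx Hf Hg. eapply has_card_ext; [intros t; apply conc_preimage, E|].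
  apply has_card_union; [now apply has_card_left_half|now apply has_card_right_half|].
  intros t [Ht H] [Ht' H']. apply Hx. rewrite <- H. f_equal. lra.
Qed.

(** The junction [t = 1/2] lies in both halves and is counted once, hence the [- 1]. *)
Lemma card_conc_eq f g x n m : f 1 = g 0 -> x = f 1 ->
  card f x n -> card g x m -> card (conc f g) x (n + m - 1).
Proof.
  intros E -> Hf Hg. eapply has_card_ext; [intros t; apply conc_preimage, E|].
  apply has_card_union_overlap with (1/2);
    [now apply has_card_left_half|now apply has_card_right_half| | |].
  - split; [lra|]. f_equal. lra.
  - split; [lra|]. rewrite E. f_equal. lra.
  - intros t [Ht H] [Ht' H']. lra.
Qed.

(** * Arms, their symmetry, and excursions *)

(* A path from level 0 to level 1 inside [0,1] meeting level 0 in [p] points, level 1 in [q]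
   points, and whose numbers of meeting points with the levels in between form the set [Q]. *)
Definition arm (f : R -> R) (p q : nat) (Q : nat -> Prop) : Prop :=
  (continuity f /\ f 0 = 0 /\ f 1 = 1 /\ (forall t, 0 <= t <= 1 -> 0 <= f t <= 1)) /\
  card f 0 p /\ card f 1 q /\
  (forall x, 0 < x < 1 -> exists k, Q k /\ card f x k) /\
  (forall k, Q k -> exists x, 0 < x < 1 /\ card f x k).

Lemma arm_ext f p p' q q' Q Q' : p = p' -> q = q' -> (forall k, Q k <-> Q' k) ->
  arm f p q Q -> arm f p' q' Q'.
Proof.
  intros -> -> E (H1 & H2 & H3 & H4 & H5). split; [easy|]. split; [easy|]. split; [easy|]. split.
  - intros x Hx. destruct (H4 x Hx) as (k & Hk & Hc). exists k. split; [now apply E|easy].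
  - intros k Hk. apply H5, E, Hk.
Qed.

Lemma arm_const_card f p q n x : arm f p q (eq n) -> 0 < x < 1 -> card f x n.
Proof.
  intros (_ & _ & _ & H & _) Hx. destruct (H x Hx) as (k & <- & Hc). easy.
Qed.

Lemma arm_line : arm (fun t => 1 * t + 0) 1 1 (eq 1%nat).
Proof.
  assert (H : forall x, 0 <= x <= 1 -> card (fun t => 1 * t + 0) x 1).
  { intros x Hx. apply card_line; lra. }
  split; [|split; [apply H; lra|split; [apply H; lra|split]]].
  - split; [apply continuity_affine|]. repeat split; lra.
  - intros x Hx. exists 1%nat. split; [easy|apply H; lra].
  - intros k <-. exists (1/2). split; [lra|apply H; lra].
Qed.

(** A half-turn of the graph about (1/2, 1/2) exchanges the two extreme levels and still runs from 0
    to 1. *)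
Lemma arm_flip f p q Q : arm f p q Q -> arm (fun t => (-1) * f (1 - t) + 1) q p Q.
Proof.
  intros ((C & F0 & F1 & Rg) & H0 & H1 & H2 & H3).
  assert (Hc : forall x y k, y = 1 - x -> card f x k -> card (fun t => (-1) * f (1 - t) + 1) y k).
  { intros x y k -> H. apply card_scale' with x; [lra|lra|]. now apply card_reverse. }
  split; [|split; [|split; [|split]]].
  - split.
    + apply (continuity_comp (fun t => f (1 - t)) (fun y => (-1) * y + 1));
        [|apply continuity_affine].
      apply (continuity_comp (fun t => 1 - t) f); [intros x; reg|easy].
    + split; [replace (1 - 0) with 1 by ring; lra|].
      split; [replace (1 - 1) with 0 by ring; lra|].
      intros t Ht. pose proof (Rg (1 - t)). lra.
  - apply Hc with 1; [lra|easy].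
  - apply Hc with 0; [lra|easy].
  - intros x Hx. destruct (H2 (1 - x)) as (k & Qk & Hk); [lra|]. exists k. split; [easy|].
    apply Hc with (1 - x); [lra|easy].
  - intros k Qk. destruct (H3 k Qk) as (x & Hx & Hk). exists (1 - x). split; [lra|].
    apply Hc with x; [lra|easy].
Qed.

(** Appends a straight descent [d] from 1 to 0 and a straight ascent [u] back to 1. *)
Lemma arm_excursion f p q n : arm f p q (eq n) ->
  exists g, arm g (p + 1) (q + 1) (eq (n + 2)%nat).
Proof.
  intros A. pose proof A as ((C & F0 & F1 & Rg) & H0 & H1 & _).
  set (d := fun t : R => (-1) * t + 1). set (u := fun t : R => 1 * t + 0).
  assert (E1 : f 1 = d 0) by (unfold d; lra).
  assert (E2 : conc f d 1 = u 0) by (rewrite conc_1 by easy; unfold d, u; lra).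
  assert (D1 : forall x, 0 <= x <= 1 -> card d x 1).
  { intros x Hx. apply card_line; [lra|]. lra. }
  assert (U1 : forall x, 0 <= x <= 1 -> card u x 1).
  { intros x Hx. apply card_line; lra. }
  assert (D2 : conc f d 1 = 0) by (rewrite conc_1 by easy; unfold d; lra).
  assert (G : forall x, 0 < x < 1 -> card (conc (conc f d) u) x (n + 2)).
  { intros x Hx. replace (n + 2)%nat with (n + 1 + 1)%nat by lia.
    apply card_conc_ne; [easy|lra| |apply U1; lra].
    apply card_conc_ne; [easy|lra| |apply D1; lra].
    now apply arm_const_card with p q. }
  exists (conc (conc f d) u). split; [|split; [|split; [|split]]].
  - split; [apply continuity_conc; [apply continuity_conc|]; trivial; apply continuity_affine|].
    split; [now rewrite !conc_0|]. split; [rewrite conc_1 by easy; unfold u; lra|].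
    apply (conc_range _ _ (fun y => 0 <= y <= 1)); [easy| |unfold u; intros; lra].
    apply (conc_range _ _ (fun y => 0 <= y <= 1)); [easy|easy|unfold d; intros; lra].
  (* Level 0: the turn from [d] to [u] is a single new point. *)
  - replace (p + 1)%nat with (p + 1 + 1 - 1)%nat by lia.
    apply card_conc_eq; [easy|lra| |apply U1; lra].
    apply card_conc_ne; [easy|lra|easy|apply D1; lra].
  - apply card_conc_ne; [easy|lra| |apply U1; lra].
    (* Level 1: the start of [d] is the end of [f], so only the end of [u] is new. *)
    replace q with (q + 1 - 1)%nat by lia.
    apply card_conc_eq; [easy|lra|easy|apply D1; lra].
  - intros x Hx. exists (n + 2)%nat. auto.
  - intros k <-. exists (1/2). split; [lra|]. apply G. lra.
Qed.

Lemma arm_excursions f p q n e : arm f p q (eq n) ->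
  exists g, arm g (p + e) (q + e) (eq (n + 2 * e)%nat).
Proof.
  intros A. induction e as [|e (g & G)].
  - exists f. revert A. apply arm_ext; lia.
  - apply arm_excursion in G. destruct G as (h & H). exists h. revert H.
    apply arm_ext; lia.
Qed.

(** * Joining two arms at level 1/2 *)

(** [f] is squeezed into the levels [0, 1/2] and [g] into [1/2, 1], so off level 1/2 only one of
    them contributes to a count. *)
Definition join (f g : R -> R) : R -> R :=
  conc (fun t => (1/2) * f t + 0) (fun t => (1/2) * g t + 1/2).

Section Join.
Variables (f g : R -> R) (p r s q : nat) (Q Q' : nat -> Prop).
Hypotheses (Hf : arm f p r Q) (Hg : arm g s q Q').

Lemma join_meet : (1/2) * f 1 + 0 = (1/2) * g 0 + 1/2.
Proof.
  destruct Hf as ((_ & _ & -> & _) & _). destruct Hg as ((_ & -> & _) & _). lra.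
Qed.

Lemma card_join_low x k : x < 1/2 -> card f (2 * x) k -> card (join f g) x k.
Proof.
  intros Hx H. replace k with (k + 0)%nat by lia.
  destruct Hf as ((_ & _ & F1 & _) & _). destruct Hg as ((_ & _ & _ & Rg) & _).
  apply card_conc_ne; [apply join_meet|lra| |].
  - apply card_scale' with (2 * x); [lra|lra|easy].
  - apply card_avoid. intros t Ht. pose proof (Rg t Ht). lra.
Qed.

Lemma card_join_high x k : 1/2 < x -> card g (2 * x - 1) k -> card (join f g) x k.
Proof.
  intros Hx H. change k with (0 + k)%nat.
  destruct Hf as ((_ & _ & F1 & Rf) & _).
  apply card_conc_ne; [apply join_meet|lra| |].
  - apply card_avoid. intros t Ht. pose proof (Rf t Ht). lra.
  - apply card_scale' with (2 * x - 1); [lra|lra|easy].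
Qed.

Lemma card_join_mid : card (join f g) (1/2) (r + s - 1).
Proof.
  destruct Hf as ((_ & _ & F1 & _) & _ & H1 & _). destruct Hg as (_ & H0 & _).
  apply card_conc_eq; [apply join_meet|lra| |].
  - apply card_scale' with 1; [lra|lra|easy].
  - apply card_scale' with 0; [lra|lra|easy].
Qed.

Lemma card_join_off_mid x : 0 < x < 1 -> x <> 1/2 ->
  exists k, (Q k \/ Q' k) /\ card (join f g) x k.
Proof.
  intros Hx N. destruct (Rlt_or_le x (1/2)).
  - destruct Hf as (_ & _ & _ & H2 & _). destruct (H2 (2 * x)) as (k & Qk & Hk); [lra|].
    exists k. split; [now left|]. now apply card_join_low.
  - destruct Hg as (_ & _ & _ & H2 & _). destruct (H2 (2 * x - 1)) as (k & Qk & Hk); [lra|].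
    exists k. split; [now right|]. apply card_join_high; [lra|easy].
Qed.

Lemma join_off_mid_attained k : Q k \/ Q' k ->
  exists x, 0 < x < 1 /\ x <> 1/2 /\ card (join f g) x k.
Proof.
  intros [Qk|Qk].
  - destruct Hf as (_ & _ & _ & _ & H3). destruct (H3 k Qk) as (x & Hx & Hk).
    exists (x / 2). split; [lra|]. split; [lra|]. apply card_join_low; [lra|].
    now replace (2 * (x / 2)) with x by field.
  - destruct Hg as (_ & _ & _ & _ & H3). destruct (H3 k Qk) as (x & Hx & Hk).
    exists ((x + 1) / 2). split; [lra|]. split; [lra|]. apply card_join_high; [lra|].
    now replace (2 * ((x + 1) / 2) - 1) with x by field.
Qed.

Lemma arm_join : arm (join f g) p q (fun k => (Q k \/ Q' k) \/ k = (r + s - 1)%nat).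
Proof.
  pose proof Hf as ((Cf & F0 & F1 & Rf) & Hp & _).
  pose proof Hg as ((Cg & G0 & G1 & Rg) & _ & Hq & _).
  pose proof join_meet as E.
  split; [|split; [|split; [|split]]].
  - split.
    + apply continuity_conc.
      * apply (continuity_comp f (fun y => (1/2) * y + 0)); [easy|apply continuity_affine].
      * apply (continuity_comp g (fun y => (1/2) * y + 1/2)); [easy|apply continuity_affine].
    + split; [unfold join; rewrite conc_0 by easy; lra|].
      split; [unfold join; rewrite conc_1 by easy; lra|].
      apply (conc_range _ _ (fun y => 0 <= y <= 1)); [easy| |].
      * intros t Ht. pose proof (Rf t Ht). lra.
      * intros t Ht. pose proof (Rg t Ht). lra.
  - apply card_join_low; [lra|]. now replace (2 * 0) with 0 by ring.
  - apply card_join_high; [lra|]. now replace (2 * 1 - 1) with 1 by ring.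
  - intros x Hx. destruct (Req_dec x (1/2)) as [->|N].
    + exists (r + s - 1)%nat. split; [now right|apply card_join_mid].
    + destruct (card_join_off_mid x Hx N) as (k & Qk & Hk). exists k. split; [now left|easy].
  - intros k [Qk| ->].
    + destruct (join_off_mid_attained k Qk) as (x & Hx & _ & Hk). now exists x.
    + exists (1/2). split; [lra|apply card_join_mid].
Qed.

End Join.

(** * Infinite towers of arms and their compactification *)

(** When each step runs from 0 to 1, the summand of index [i] is 0 up to [i] and 1 from [i + 1] on.
    The finite sum is then continuous on the whole line and agrees with the tower up to [s = n]. *)
Fixpoint stair (f : nat -> R -> R) (n : nat) (s : R) : R :=
  match n with
  | O => 0
  | S i => stair f i s + f i (clamp (s - INR i))
  end.

(* Stacks the unit steps [f 0, f 1, ...] on top of each other: on [i, i+1] it is [i + f i (s - i)]. *)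
Definition tower (f : nat -> R -> R) (s : R) : R := stair f (Z.to_nat (up s)) s.

(* The homeomorphism s |-> s / (1 + s) from [0, infinity) onto [0, 1), applied to both axes. *)
Definition compactified_tower (f : nat -> R -> R) (t : R) : R :=
  if Rlt_dec t 1 then tower f (t / (1 - t)) / (1 + tower f (t / (1 - t))) else 1.

Lemma Rle_up_nat s : s <= INR (Z.to_nat (up s)).
Proof.
  destruct (archimed s) as [H _]. rewrite INR_IZR_INZ.
  apply Rle_trans with (IZR (up s)); [lra|]. apply IZR_le. lia.
Qed.

Lemma nat_floor s : 0 <= s -> exists j : nat, INR j <= s < INR (S j).
Proof.
  intros Hs. destruct (archimed s) as [H1 H2].
  assert (0 < up s)%Z by (apply lt_IZR; lra).
  exists (Z.to_nat (up s - 1)). rewrite S_INR, INR_IZR_INZ, Z2Nat.id, minus_IZR by lia. lra.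
Qed.

Lemma Rdiv_lt_of_lt_mult a b c : 0 < b -> a < c * b -> a / b < c.
Proof.
  intros Hb H. apply Rmult_lt_reg_r with b; [easy|].
  now replace (a / b * b) with a by (field; lra).
Qed.

Lemma Rlt_div_of_mult_lt a b c : 0 < b -> c * b < a -> c < a / b.
Proof.
  intros Hb H. apply Rmult_lt_reg_r with b; [easy|].
  now replace (a / b * b) with a by (field; lra).
Qed.

Section Tower.
Variables (f : nat -> R -> R) (p q : nat -> nat) (Q : nat -> nat -> Prop).
Hypothesis Hf : forall i, arm (f i) (p i) (q i) (Q i).

Lemma step_0 i : f i 0 = 0.
Proof. now destruct (Hf i) as ((_ & H & _) & _). Qed.

Lemma step_1 i : f i 1 = 1.
Proof. now destruct (Hf i) as ((_ & _ & H & _) & _). Qed.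

Lemma step_range i t : 0 <= t <= 1 -> 0 <= f i t <= 1.
Proof. destruct (Hf i) as ((_ & _ & _ & H) & _). apply H. Qed.

Lemma stair_stable n m s : (n <= m)%nat -> s <= INR n -> stair f m s = stair f n s.
Proof.
  intros L Hs. induction L as [|m L IH]; [easy|]. simpl. rewrite IH.
  apply le_INR in L. rewrite clamp_low, step_0; lra.
Qed.

Lemma tower_stair n s : s <= INR n -> tower f s = stair f n s.
Proof.
  intros Hs. unfold tower.
  rewrite <- (stair_stable _ (max (Z.to_nat (up s)) n) s); [|lia|apply Rle_up_nat].
  apply stair_stable; [lia|easy].
Qed.

Lemma stair_full n s : INR n <= s -> stair f n s = INR n.
Proof.
  induction n as [|n IH]; intros Hs; [easy|]. rewrite S_INR in *. simpl.
  rewrite IH, clamp_high, step_1 by lra. easy.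
Qed.

Lemma tower_step j s : INR j <= s <= INR j + 1 -> tower f s = INR j + f j (s - INR j).
Proof.
  intros Hs. rewrite (tower_stair (S j)) by (rewrite S_INR; lra). simpl.
  rewrite stair_full, clamp_id by lra. easy.
Qed.

Lemma continuity_stair n : continuity (stair f n).
Proof.
  induction n as [|n IH].
  - intros x. apply continuity_const. intros a b. reflexivity.
  - apply (continuity_plus (stair f n) (fun s => f n (clamp (s - INR n)))); [easy|].
    apply (continuity_comp (fun s => clamp (s - INR n)) (f n)).
    + apply (continuity_comp (fun s => s - INR n) clamp); [intros x; reg|apply continuity_clamp].
    + now destruct (Hf n) as ((H & _) & _).
Qed.

(** Within distance 1 of [s] the tower coincides with one fixed finite [stair]. *)
Lemma continuity_tower : continuity (tower f).
Proof.
  intros s. set (n := S (Z.to_nat (up s))).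
  apply continuity_pt_locally_ext with (stair f n) 1; [lra| |apply continuity_stair].
  intros y Hy. symmetry. apply tower_stair. unfold n. rewrite S_INR.
  pose proof (Rle_up_nat s). unfold Rdist in Hy. split_Rabs; lra.
Qed.

Lemma tower_nonneg s : 0 <= tower f s.
Proof.
  unfold tower. induction (Z.to_nat (up s)) as [|n IH]; simpl; [lra|].
  pose proof (step_range n _ (clamp_range (s - INR n))). lra.
Qed.

(** Drives the tower to infinity, which yields continuity of the compactified tower at 1. *)
Lemma tower_lower s : s - 1 <= tower f s.
Proof.
  destruct (Rle_or_lt s 0) as [H|H]; [pose proof (tower_nonneg s); lra|].
  destruct (nat_floor s) as (j & Hj); [lra|]. rewrite S_INR in Hj.
  rewrite (tower_step j) by lra. pose proof (step_range j (s - INR j)). lra.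
Qed.

Lemma compactified_tower_lt1 t : t < 1 -> 0 <= compactified_tower f t < 1.
Proof.
  intros Ht. unfold compactified_tower. destruct (Rlt_dec t 1) as [_|]; [|easy].
  pose proof (tower_nonneg (t / (1 - t))) as H. set (y := tower f (t / (1 - t))) in *.
  split; [apply Rle_mult_inv_pos|apply Rdiv_lt_of_lt_mult]; lra.
Qed.

Lemma continuity_compactified_tower : continuity (compactified_tower f).
Proof.
  intros t. destruct (Rtotal_order t 1) as [Ht|[->|Ht]].
  - apply continuity_pt_locally_ext with
      (fun t => tower f (t / (1 - t)) / (1 + tower f (t / (1 - t)))) (1 - t); [lra| |].
    + intros y Hy. unfold compactified_tower. destruct (Rlt_dec y 1) as [|N]; [easy|].
      unfold Rdist in Hy. split_Rabs; lra.
    + assert (C : continuity_pt (fun t => tower f (t / (1 - t))) t).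
      { apply (continuity_pt_comp (fun t => t / (1 - t)) (tower f)); [|apply continuity_tower].
        reg. lra. }
      apply (continuity_pt_div (fun t => tower f (t / (1 - t)))
               (fun t => 1 + tower f (t / (1 - t)))); [easy| |].
      * apply (continuity_pt_plus (fun _ => 1) (fun t => tower f (t / (1 - t)))); [reg|easy].
      * pose proof (tower_nonneg (t / (1 - t))). lra.
  - intros eps He. exists (Rmin (eps / 2) (1/2)). split; [apply Rmin_case; lra|].
    intros y [_ Hy]. simpl in *. unfold Rdist in *.
    replace (compactified_tower f 1) with 1
      by (unfold compactified_tower; destruct (Rlt_dec 1 1); lra).
    destruct (Rlt_or_le y 1) as [Hy1|Hy1].
    + pose proof (compactified_tower_lt1 y Hy1).
      rewrite Rabs_left by lra.
      assert (Hd : 1 - y < eps / 2 /\ 1 - y < 1/2).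
      { pose proof (Rmin_l (eps / 2) (1/2)). pose proof (Rmin_r (eps / 2) (1/2)).
        rewrite Rabs_left in Hy by lra. lra. }
      unfold compactified_tower. destruct (Rlt_dec y 1) as [_|]; [|easy].
      pose proof (tower_nonneg (y / (1 - y))) as G0. pose proof (tower_lower (y / (1 - y))) as G.
      set (z := tower f (y / (1 - y))) in *.
      replace (- (z / (1 + z) - 1)) with (1 / (1 + z)) by (field; lra).
      apply Rdiv_lt_of_lt_mult; [lra|].
      assert (y / (1 - y) = 1 / (1 - y) - 1) by (field; lra).
      assert (2 < eps * (1 / (1 - y))).
      { replace (eps * (1 / (1 - y))) with (eps / (1 - y)) by (field; lra).
        apply Rlt_div_of_mult_lt; lra. }
      assert (eps * (1 / (1 - y) - 1) <= eps * (1 + z)) by (apply Rmult_le_compat_l; lra).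
      (* The goal is [1 < eps * (1 + z)]. The bounds above give [eps * (1 + z) > 2 - eps], enough if
         [eps <= 1]; otherwise [z >= 0] suffices. *)
      destruct (Rle_or_lt eps 1); nra.
    + unfold compactified_tower. destruct (Rlt_dec y 1); [lra|].
      replace (1 - 1) with 0 by ring. now rewrite Rabs_R0.
  - apply continuity_pt_locally_ext with (fun _ => 1) (t - 1); [lra| |reg].
    intros y Hy. unfold compactified_tower. destruct (Rlt_dec y 1) as [|N]; [|easy].
    unfold Rdist in Hy. split_Rabs; lra.
Qed.

(** Step [i] stays within the levels [i, i + 1], so a level strictly between [j] and [j + 1] is met
    on step [j] only. *)
Lemma tower_preimage s y j :
  0 <= s -> INR j < y < INR j + 1 -> tower f s = y ->
  INR j <= s <= INR j + 1 /\ f j (s - INR j) = y - INR j.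
Proof.
  intros Hs Hy E. destruct (nat_floor s Hs) as (i & Hi). rewrite S_INR in Hi.
  rewrite (tower_step i) in E by lra. pose proof (step_range i (s - INR i)).
  assert (i = j).
  { assert (INR i < INR j + 1) as H1 by lra. assert (INR j < INR i + 1) as H2 by lra.
    rewrite <- S_INR in H1, H2. apply INR_lt in H1, H2. lia. }
  subst i. split; lra.
Qed.

(** A positive integer level can only be the top of one step or the bottom of the next. *)
Lemma tower_preimage_nat s j : 0 <= s -> tower f s = INR (S j) ->
  (INR j <= s <= INR j + 1 /\ f j (s - INR j) = 1) \/
  (INR (S j) <= s <= INR (S j) + 1 /\ f (S j) (s - INR (S j)) = 0).
Proof.
  intros Hs E. destruct (nat_floor s Hs) as (i & Hi). rewrite S_INR in Hi.
  rewrite (tower_step i) in E by lra. pose proof (step_range i (s - INR i)).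
  assert (i = j \/ i = S j) as [-> | ->].
  { assert (INR i <= INR (S j)) as H1 by lra. assert (INR (S j) <= INR i + 1) as H2 by lra.
    rewrite <- S_INR in H2. apply INR_le in H1, H2. lia. }
  - left. rewrite S_INR in E. lra.
  - right. lra.
Qed.

Lemma has_card_step j w k : card (f j) w k ->
  has_card (fun s => INR j <= s <= INR j + 1 /\ f j (s - INR j) = w) k.
Proof.
  intros H.
  apply (has_card_image _ _ _ (fun t => INR j + t) (fun s => s - INR j) H); unfold preim01.
  - intros t [Ht E]. replace (INR j + t - INR j) with t by ring. repeat split; lra.
  - intros s [Hs E]. repeat split; lra.
Qed.

Lemma card_tower_interior j w k : 0 < w < 1 -> card (f j) w k ->
  has_card (fun s => 0 <= s /\ tower f s = INR j + w) k.
Proof.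
  intros Hw H. apply has_card_step in H. revert H. apply has_card_ext. intros s.
  pose proof (pos_INR j). split.
  - intros [Hs E]. split; [lra|]. rewrite (tower_step j) by lra. lra.
  - intros [Hs E]. apply (tower_preimage _ _ j) in E; lra.
Qed.

Lemma card_tower_nat j :
  has_card (fun s => 0 <= s /\ tower f s = INR (S j)) (q j + p (S j) - 1).
Proof.
  destruct (Hf j) as (_ & _ & H1 & _). destruct (Hf (S j)) as (_ & H2 & _).
  apply has_card_step in H1, H2. pose proof (pos_INR j).
  eapply has_card_ext;
    [|apply (has_card_union_overlap _ _ _ _ (INR (S j)) H1 H2); rewrite ?S_INR].
  - intros s. split.
    + intros [[Hs E]|[Hs E]].
      * split; [lra|]. rewrite S_INR, (tower_step j) by lra. lra.
      * rewrite S_INR in Hs. split; [lra|]. rewrite (tower_step (S j)); rewrite ?S_INR in *; lra.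
    + intros [Hs E]. now apply tower_preimage_nat.
  - split; [lra|]. replace (INR j + 1 - INR j) with 1 by ring. apply step_1.
  - split; [lra|]. replace (INR j + 1 - (INR j + 1)) with 0 by ring. apply step_0.
  - intros s [Hs _] [Hs' _]. lra.
Qed.

Lemma card_tower_0 : has_card (fun s => 0 <= s /\ tower f s = 0) (p 0).
Proof.
  destruct (Hf 0) as (_ & H & _). apply has_card_step in H. revert H. apply has_card_ext.
  intros s. simpl. split.
  - intros [Hs E]. split; [lra|]. rewrite (tower_step 0); simpl; lra.
  - intros [Hs E]. destruct (nat_floor s Hs) as (i & Hi). rewrite S_INR in Hi.
    pose proof (pos_INR i).
    rewrite (tower_step i) in E by lra. pose proof (step_range i (s - INR i)).
    assert (i = 0)%nat by (apply INR_eq; simpl; lra). subst i. simpl in *. lra.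
Qed.

(** The bijection [t |-> t / (1 - t)] carries the points at level [x] to those of the tower at level
    [x / (1 - x)]; [t = 1] does not interfere, its level being 1. *)
Lemma card_compactified_tower x k : 0 <= x < 1 ->
  has_card (fun s => 0 <= s /\ tower f s = x / (1 - x)) k -> card (compactified_tower f) x k.
Proof.
  intros Hx H.
  apply (has_card_image _ _ _ (fun s => s / (1 + s)) (fun t => t / (1 - t)) H); unfold preim01.
  - intros s [Hs E].
    assert (Hr : 0 <= s / (1 + s) < 1).
    { split; [apply Rle_mult_inv_pos|apply Rdiv_lt_of_lt_mult]; lra. }
    assert (E' : s / (1 + s) / (1 - s / (1 + s)) = s) by (field; lra).
    split; [|easy]. split; [lra|]. unfold compactified_tower.
    destruct (Rlt_dec (s / (1 + s)) 1); [|lra]. rewrite E', E. field. lra.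
  - intros t [Ht E]. unfold compactified_tower in E. destruct (Rlt_dec t 1); [|lra].
    split; [|field; lra]. split; [apply Rle_mult_inv_pos; lra|].
    rewrite <- E. pose proof (tower_nonneg (t / (1 - t))).
    field. lra.
Qed.

(** The tower takes finite values, so level 1 is met at [t = 1] only, whatever the top counts of the
    steps. Every level in between is interior to a step or a junction of two consecutive steps. *)
Lemma arm_tower : arm (compactified_tower f) (p 0) 1
  (fun k => (exists i, Q i k) \/ exists i, k = (q i + p (S i) - 1)%nat).
Proof.
  assert (T1 : compactified_tower f 1 = 1).
  { unfold compactified_tower. destruct (Rlt_dec 1 1); lra. }
  assert (L : forall y, 0 <= y -> 0 <= y / (1 + y) < 1 /\ y / (1 + y) / (1 - y / (1 + y)) = y).
  { intros y Hy. split; [split; [apply Rle_mult_inv_pos|apply Rdiv_lt_of_lt_mult]; lra|field; lra]. }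
  split; [|split; [|split; [|split]]].
  - split; [apply continuity_compactified_tower|]. split; [|split; [easy|]].
    + unfold compactified_tower. destruct (Rlt_dec 0 1); [|lra].
      replace (0 / (1 - 0)) with 0 by field.
      rewrite (tower_step 0) by (simpl; lra). simpl.
      replace (0 - 0) with 0 by ring. rewrite step_0. field.
    + intros t Ht. destruct (Rlt_or_le t 1) as [H|H].
      * pose proof (compactified_tower_lt1 t H). lra.
      * replace t with 1 by lra. lra.
  - apply card_compactified_tower; [lra|]. replace (0 / (1 - 0)) with 0 by field.
    apply card_tower_0.
  - apply has_card_singleton with 1. intros t. unfold preim01. split.
    + intros [Ht E]. destruct (Rlt_or_le t 1) as [H|H]; [|lra].
      pose proof (compactified_tower_lt1 t H). lra.
    + intros ->. split; [lra|easy].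
  - intros x Hx. assert (Hy : 0 < x / (1 - x)) by (apply Rdiv_lt_0_compat; lra).
    destruct (nat_floor (x / (1 - x))) as (j & Hj); [lra|]. rewrite S_INR in Hj.
    destruct (Req_dec (x / (1 - x)) (INR j)) as [E|N].
    + destruct j as [|j]; [simpl in E; lra|].
      exists (q j + p (S j) - 1)%nat. split; [right; now exists j|].
      apply card_compactified_tower; [lra|]. rewrite E. apply card_tower_nat.
    + destruct (Hf j) as (_ & _ & _ & H & _).
      destruct (H (x / (1 - x) - INR j)) as (k & Qk & Hk); [lra|].
      exists k. split; [left; now exists j|]. apply card_compactified_tower; [lra|].
      apply card_tower_interior in Hk; [|lra].
      now replace (INR j + (x / (1 - x) - INR j)) with (x / (1 - x)) in Hk by ring.
  - assert (A : forall y k, 0 < y -> has_card (fun s => 0 <= s /\ tower f s = y) k ->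
      exists x, 0 < x < 1 /\ card (compactified_tower f) x k).
    { intros y k Hy H. destruct (L y) as [L1 L2]; [lra|]. exists (y / (1 + y)).
      split; [split; [apply Rdiv_lt_0_compat; lra|lra]|].
      apply card_compactified_tower; [lra|]. now rewrite L2. }
    intros k [[i Qk]|[i ->]].
    + destruct (Hf i) as (_ & _ & _ & _ & H). destruct (H k Qk) as (w & Hw & Hk).
      apply A with (INR i + w); [pose proof (pos_INR i); lra|]. now apply card_tower_interior.
    + apply A with (INR (S i)); [apply lt_0_INR; lia|apply card_tower_nat].
Qed.

End Tower.

(** * Levels just below a maximum *)

(** Insertion sort; the absence of duplicates makes the order strict. *)
Lemma sorted_enumeration (l : list R) : NoDup l ->
  exists l', StronglySorted Rlt l' /\ Permutation l l'.
Proof.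
  induction l as [|a l IH]; intros D.
  - exists nil. split; constructor.
  - inversion D as [|? ? Ha Dl]; subst. destruct (IH Dl) as (l' & Sl & P).
    assert (Ha' : ~ In a l') by (intros H; apply Ha; now apply (Permutation_in _ (Permutation_sym P))).
    assert (I : exists l2, StronglySorted Rlt l2 /\ Permutation (a :: l') l2).
    { clear - Sl Ha'. induction Sl as [|b l' Sl IH F].
      - exists (a :: nil). split; [repeat constructor|reflexivity].
      - destruct (Rtotal_order a b) as [H|[H|H]].
        + exists (a :: b :: l'). split; [|reflexivity]. constructor; [now constructor|].
          constructor; [easy|]. revert F. apply Forall_impl. intros c. lra.
        + subst b. exfalso. apply Ha'. now left.
        + destruct IH as (l2 & S2 & P2); [intros C; apply Ha'; now right|].
          exists (b :: l2). split.
          * constructor; [easy|]. apply Forall_forall. intros c Hc.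
            apply (Permutation_in _ (Permutation_sym P2)) in Hc. destruct Hc as [<-|Hc]; [easy|].
            rewrite Forall_forall in F. auto.
          * rewrite perm_swap. now constructor. }
    destruct I as (l2 & S2 & P2). exists l2. split; [easy|].
    rewrite <- P2. now constructor.
Qed.

Lemma IVT_level F y a b : continuity F -> a < b ->
  (F a < y < F b \/ F b < y < F a) -> exists z, a < z < b /\ F z = y.
Proof.
  intros C Hab H.
  destruct (IVT_cor (fun t => F t - y) a b) as (z & Hz & E).
  - apply continuity_minus; [easy|]. intros x. reg.
  - lra.
  - destruct H; nra.
  - exists z. split; [|lra].
    destruct (Req_dec z a) as [->|]; [lra|]. destruct (Req_dec z b) as [->|]; lra.
Qed.

(* Between two consecutive maximum points every level just below the maximum is met twice,
   and once more between the last of them and 1. *)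
Lemma preimages_below_max F mx l a : continuity F -> StronglySorted Rlt (a :: l) ->
  (forall t, In t (a :: l) -> t <= 1 /\ F t = mx) ->
  (forall t, a <= t <= 1 -> F t = mx -> In t (a :: l)) ->
  (forall t, a <= t <= 1 -> F t <= mx) -> F 1 < mx ->
  exists c, c < mx /\ forall y, c < y < mx ->
    exists l', NoDup l' /\ length l' = (2 * length l + 1)%nat /\
      forall t, In t l' -> a < t <= 1 /\ F t = y.
Proof.
  intros C. revert a. induction l as [|b l IH]; intros a Srt Hl Hmax Hle H1.
  (* With [a] the last maximum point, the path still has to fall to [F 1], crossing every level in
     between. *)
  - exists (F 1). split; [easy|]. intros y Hy.
    destruct (Hl a) as [Ha Fa]; [now left|].
    destruct (IVT_level F y a 1) as (z & Hz & E); [easy| |lra|].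
    { destruct (Req_dec a 1) as [->|]; lra. }
    exists (z :: nil). split; [repeat constructor; easy|]. split; [easy|].
    intros t [<-|[]]. lra.
  - inversion Srt as [|? ? Srt' Fab]; subst.
    assert (Hab : a < b) by now inversion Fab.
    destruct (Hl a) as [Ha Fa]; [now left|]. destruct (Hl b) as [Hb Fb]; [right; now left|].
    destruct (IH b Srt') as (c & Hc & Hy).
    { intros t Ht. apply Hl. now right. }
    { intros t Ht E. destruct (Hmax t) as [<-|]; [lra|easy|lra|easy]. }
    { intros t Ht. apply Hle. lra. }
    { easy. }
    set (mid := (a + b) / 2).
    assert (Hm : a < mid < b) by (unfold mid; lra).
    assert (Fm : F mid < mx).
    (* A maximum at [mid] would be listed, but [a] and [b] are consecutive in the sorted list. *)
    { destruct (Hle mid) as [|E]; [lra|easy|]. exfalso.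
      destruct (Hmax mid) as [E'|E']; [lra|easy|lra|].
      destruct E' as [E'|E']; [lra|]. inversion Srt' as [|? ? _ Fb']; subst.
      rewrite Forall_forall in Fb'. apply Fb' in E'. lra. }
    (* Levels above [F mid] are crossed on the way from [a] to [mid] and again from [mid] to [b];
       the points supplied by induction all lie after [b]. *)
    exists (Rmax c (F mid)). split; [now apply Rmax_lub_lt|].
    intros y [Hy1 Hy2]. apply Rmax_Rlt in Hy1.
    destruct (Hy y) as (l' & D' & L' & Hl'); [lra|].
    destruct (IVT_level F y a mid) as (z1 & Hz1 & E1); [easy|lra|lra|].
    destruct (IVT_level F y mid b) as (z2 & Hz2 & E2); [easy|lra|lra|].
    exists (z1 :: z2 :: l'). split; [|split].
    + constructor; [|constructor; [|easy]].
      * intros [E|I]; [lra|]. apply Hl' in I. lra.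
      * intros I. apply Hl' in I. lra.
    + simpl. lia.
    + intros t [<-|[<-|I]]; [lra|lra|]. apply Hl' in I. lra.
Qed.

Lemma level_below_max F n x0 : continuity F -> 0 <= x0 <= 1 ->
  (forall t, 0 <= t <= 1 -> F t <= F x0) -> F 1 < F x0 -> card F (F x0) n ->
  exists y l, NoDup l /\ length l = (2 * n - 1)%nat /\ forall t, In t l -> preim01 F y t.
Proof.
  intros C Hx0 Hmax H1 (l & D & L & Hl).
  destruct (sorted_enumeration l D) as (l' & Srt & P).
  assert (Hl' : forall t, In t l' <-> preim01 F (F x0) t).
  { intros t. rewrite <- Hl. split; apply Permutation_in; [now symmetry|easy]. }
  apply Permutation_length in P.
  destruct l' as [|a l'].
  { exfalso. now apply (Hl' x0). }
  destruct (Hl' a) as [[Ha _] _]; [now left|].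
  destruct (preimages_below_max F (F x0) l' a) as (c & Hc & H); trivial.
  - intros t Ht. apply Hl' in Ht. unfold preim01 in Ht. lra.
  - intros t Ht E. apply Hl'. split; [lra|easy].
  - intros t Ht. apply Hmax. lra.
  - destruct (H ((c + F x0) / 2)) as (l2 & D2 & L2 & H2); [lra|].
    exists ((c + F x0) / 2), l2. split; [easy|]. split.
    (* Here [l'] lacks the first maximum point [a], so [n] is its length plus 1 and
       [2 * (n - 1) + 1 = 2 * n - 1]. *)
    + rewrite L2. simpl in P. lia.
    + intros t Ht. apply H2 in Ht. unfold preim01. lra.
Qed.

(** The fibre contains the [n + 1] points 1, 1/2, ..., 1/(n + 1). *)
Lemma constant_infinite_fibre f y n : (forall t, 0 <= t <= 1 -> f t = y) -> ~ card f y n.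
Proof.
  intros H Hc.
  assert (L : (length (map (fun i => / INR (S i)) (seq 0 (S n))) <= n)%nat).
  { apply (has_card_incl_length _ _ _ Hc).
    - apply NoDup_map_NoDup_ForallPairs; [|apply seq_NoDup].
      intros i j _ _ E. apply Rinv_eq_reg in E. apply INR_eq in E. lia.
    - intros t Ht. apply in_map_iff in Ht. destruct Ht as (i & <- & _).
      assert (Hi : 1 <= INR (S i)) by (rewrite S_INR; pose proof (pos_INR i); lra).
      assert (0 <= / INR (S i) <= 1).
      { split; [apply Rlt_le, Rinv_0_lt_compat; lra|].
        rewrite <- Rinv_1. apply Rinv_le_contravar; lra. }
      split; [easy|]. now apply H. }
  rewrite length_map, length_seq in L. lia.
Qed.

Lemma card_reverse_iff f x n : card (fun t => f (1 - t)) x n <-> card f x n.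
Proof.
  split; intros H; [|now apply card_reverse].
  apply card_reverse in H. revert H. apply has_card_ext. intros t. unfold preim01.
  now replace (1 - (1 - t)) with t by ring.
Qed.

(** * Necessity of the inequality *)

Lemma dense_level F m : continuity F ->
  (forall x, is_finite_set (preim01 F x)) ->
  (forall x n, card F x n -> n <> 0%nat -> (m <= n)%nat) ->
  exists y n, card F y n /\ (2 * m - 1 <= n)%nat.
Proof.
  intros C Fin Hm.
  (* One of the maxima of F, of F run backwards and of -F is not attained at 1. *)
  assert (K : forall G, continuity G -> (forall x, is_finite_set (preim01 G x)) ->
    (forall x n, card G x n -> n <> 0%nat -> (m <= n)%nat) ->
    forall x0, 0 <= x0 <= 1 -> (forall t, 0 <= t <= 1 -> G t <= G x0) -> G 1 < G x0 ->
    exists y n, card G y n /\ (2 * m - 1 <= n)%nat).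
  { intros G CG FG HG x0 Hx0 Hmax H1.
    destruct (FG (G x0)) as (n & Hn).
    destruct (level_below_max G n x0) as (y & l & D & L & Hl); trivial.
    destruct (FG y) as (k & Hk). exists y, k. split; [easy|].
    assert (n <> 0%nat) by (apply (has_card_nonempty _ _ x0 Hn); split; auto).
    pose proof (HG _ _ Hn). pose proof (has_card_incl_length _ _ _ Hk D Hl). lia. }
  destruct (continuity_ab_maj F 0 1) as (x0 & Hmax & Hx0); [lra|intros; apply C|].
  destruct (Rlt_or_le (F 1) (F x0)) as [H1|H1].
  { now apply (K F C Fin Hm x0). }
  (* From here on the maximum is attained at 1; if it is not attained at 0, the reversed path
     qualifies. *)
  destruct (Rlt_or_le (F 0) (F x0)) as [H0|H0].
  { destruct (K (fun t => F (1 - t))) with (x0 := 1 - x0) as (y & n & Hy & L).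
    - apply (continuity_comp (fun t => 1 - t) F); [intros x; reg|easy].
    - intros x. destruct (Fin x) as (n & Hn). exists n. now apply card_reverse.
    - intros x n H. apply (Hm x). apply card_reverse_iff, H.
    - lra.
    - intros t Ht. replace (1 - (1 - x0)) with x0 by ring. apply Hmax. lra.
    - replace (1 - 1) with 0 by ring. now replace (1 - (1 - x0)) with x0 by ring.
    - exists y, n. split; [|easy]. apply card_reverse_iff, Hy. }
  (* Both ends are now maximal, so unless [F] is constant its minimum is not attained at 1 and [- F]
     qualifies. *)
  destruct (continuity_ab_min F 0 1) as (x1 & Hmin & Hx1); [lra|intros; apply C|].
  destruct (Rlt_or_le (F x1) (F 1)) as [H2|H2].
  { assert (E : forall x n, card (fun t => (-1) * F t + 0) x n <-> card F (- x) n).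
    { intros x n. split; [|intros H; apply card_scale' with (- x); [lra|lra|easy]].
      apply has_card_ext. intros t. unfold preim01. split; intros [Ht E]; split; lra. }
    destruct (K (fun t => (-1) * F t + 0)) with (x0 := x1) as (y & n & Hy & L).
    - apply (continuity_comp F (fun y => (-1) * y + 0)); [easy|apply continuity_affine].
    - intros x. destruct (Fin (- x)) as (n & Hn). exists n. now apply E.
    - intros x n H. apply (Hm (- x)). now apply E.
    - easy.
    - intros t Ht. pose proof (Hmin t Ht). lra.
    - lra.
    - exists (- y), n. split; [|easy]. now apply E. }
  exfalso. destruct (Fin (F 1)) as (n & Hn).
  apply (constant_infinite_fibre F (F 1) n); [|easy].
  intros t Ht. pose proof (Hmax t Ht). pose proof (Hmin t Ht). lra.
Qed.

Lemma bounded_has_max (S : nat -> Prop) B k : S k -> (forall n, S n -> (n <= B)%nat) ->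
  exists M, S M /\ forall n, S n -> (n <= M)%nat.
Proof.
  revert k. induction B as [|B IH]; intros k Hk HB.
  - exists k. split; [easy|]. intros n Hn. apply HB in Hn. lia.
  - destruct (classic (S (Datatypes.S B))) as [H|H]; [now exists (Datatypes.S B)|].
    apply (IH k Hk). intros n Hn. pose proof (HB n Hn).
    assert (n <> Datatypes.S B) by congruence. lia.
Qed.

Lemma realizable_m2_ge f (S : nat -> Prop) : cont_on_01 f -> Omega_eq f S -> m2_ge S.
Proof.
  intros C [Fin HS] m (Sm & _ & Hmin).
  destruct (classic (nat_bounded S)) as [(B & HB)|N]; [right|now left].
  destruct (bounded_has_max S B m Sm HB) as (M & SM & HM).
  exists M. split; [easy|]. split; [easy|].
  destruct (dense_level (fun t => f (clamp t)) m) as (y & n & Hn & L).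
  - now apply continuity_clamp_extension.
  - intros x. destruct (Fin x) as (n & Hn). exists n. apply (card_clamp_extension f x n), Hn.
  - intros x n H. apply Hmin. apply HS. exists x. apply card_clamp_extension, H.
  - apply Nat.le_trans with n; [easy|]. apply HM, HS. exists y. apply card_clamp_extension, Hn.
Qed.

(** * Bands: arms with prescribed extreme counts and constant odd count in between *)

Lemma zigzag j : exists f, arm f (j + 1) (j + 1) (eq (2 * j + 1)%nat).
Proof.
  destruct (arm_excursions _ _ _ _ j arm_line) as (f & H). exists f. revert H.
  apply arm_ext; lia.
Qed.

(** Put [i = j + 1 - q]. A tower of equal zigzags has junction counts
    [(i + 1) + (i + 1) - 1 = 2 * i + 1], the same as inside the steps, so it has counts [i + 1] at
    level 0, 1 at level 1 and [2 * i + 1] in between. Then [q - 1] excursions raise these to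
    [j + 1], [q] and [2 * j + 1]. *)
Lemma arm_top j q : (1 <= q <= j + 1)%nat -> exists f, arm f (j + 1) q (eq (2 * j + 1)%nat).
Proof.
  intros Hq. destruct (zigzag (j + 1 - q)) as (f & Hf).
  pose proof (arm_tower (fun _ => f) _ _ _ (fun _ => Hf)) as H.
  apply arm_ext with (p' := (j + 1 - q + 1)%nat) (q' := 1%nat)
    (Q' := eq (2 * (j + 1 - q) + 1)%nat) in H; trivial.
  - destruct (arm_excursions _ _ _ _ (q - 1) H) as (g & Hg). exists g. revert Hg.
    apply arm_ext; lia.
  - intros k. split.
    + intros [[_ <-]|[_ ->]]; lia.
    + intros <-. left. now exists 0%nat.
Qed.

(** Two arms are joined along their ends of count [j + 1], so the junction also has count
    [2 * j + 1]. *)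
Lemma band j p q : (1 <= p <= j + 1)%nat -> (1 <= q <= j + 1)%nat ->
  exists f, arm f p q (eq (2 * j + 1)%nat).
Proof.
  intros Hp Hq. destruct (arm_top j p Hp) as (f & Hf). destruct (arm_top j q Hq) as (g & Hg).
  apply arm_flip in Hf. eexists. generalize (arm_join _ _ _ _ _ _ _ _ Hf Hg).
  apply arm_ext; trivial. lia.
Qed.

(** Each [k] in [L] becomes the count of a junction of two bands: [k = r + s - 1] with
    [r = min k (j + 1)] and [s = k + 1 - r], both between 1 and [j + 1] because [k <= 2 * j + 1].
    The rest of the list is realized by an arm with bottom count [s]. *)
Lemma arm_of_list j L p q : (1 <= p <= j + 1)%nat -> (1 <= q <= j + 1)%nat ->
  (forall k, In k L -> 1 <= k <= 2 * j + 1)%nat ->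
  exists f, arm f p q (fun k => k = (2 * j + 1)%nat \/ In k L).
Proof.
  intros Hp Hq. revert p Hp. induction L as [|k L IH]; intros p Hp HL.
  - destruct (band j p q Hp Hq) as (f & Hf). exists f. revert Hf. apply arm_ext; trivial.
    intros k. simpl. lia.
  - assert (Hk : (1 <= k <= 2 * j + 1)%nat) by (apply HL; now left).
    destruct (band j p (min k (j + 1))) as (f & Hf); [lia|lia|].
    destruct (IH (k + 1 - min k (j + 1))%nat) as (g & Hg); [lia| |].
    { intros i Hi. apply HL. now right. }
    eexists. generalize (arm_join _ _ _ _ _ _ _ _ Hf Hg). apply arm_ext; trivial.
    intros i. simpl.
    replace (min k (j + 1) + (k + 1 - min k (j + 1)) - 1)%nat with k by lia.
    intuition auto.
Qed.

(** * Arms with a prescribed count at level 1/2 *)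

(* An arm where the number of meeting points with level 1/2 is prescribed separately. *)
Definition split_arm (f : R -> R) (m K : nat) (Q : nat -> Prop) : Prop :=
  (continuity f /\ f 0 = 0 /\ f 1 = 1 /\ (forall t, 0 <= t <= 1 -> 0 <= f t <= 1)) /\
  card f 0 m /\ card f 1 m /\ card f (1/2) K /\
  (forall x, 0 < x < 1 -> x <> 1/2 -> exists k, Q k /\ card f x k) /\
  (forall k, Q k -> exists x, 0 < x < 1 /\ x <> 1/2 /\ card f x k).

Lemma split_arm_join f g m r s K Q Q' T : arm f m r Q -> arm g s m Q' ->
  K = (r + s - 1)%nat -> (forall k, T k <-> Q k \/ Q' k) -> split_arm (join f g) m K T.
Proof.
  intros Hf Hg -> HT. pose proof (arm_join _ _ _ _ _ _ _ _ Hf Hg) as (H1 & H2 & H3 & _).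
  split; [easy|]. split; [easy|]. split; [easy|]. split; [|split].
  - eapply card_join_mid; eauto.
  - intros x Hx N. destruct (card_join_off_mid _ _ _ _ _ _ _ _ Hf Hg x Hx N) as (k & Qk & Hk).
    exists k. split; [now apply HT|easy].
  - intros k Tk. apply (join_off_mid_attained _ _ _ _ _ _ _ _ Hf Hg), HT, Tk.
Qed.

Lemma bounded_list (T : nat -> Prop) B : exists L, forall k, In k L <-> (k <= B)%nat /\ T k.
Proof.
  induction B as [|B (L & HL)].
  - destruct (classic (T 0%nat)) as [H|H].
    + exists (0%nat :: nil). intros k. simpl. split.
      * intros [<-|[]]. auto.
      * intros [Hk _]. left. lia.
    + exists nil. intros k. split; [easy|]. intros [Hk Tk].
      replace k with 0%nat in Tk by lia. easy.
  - destruct (classic (T (S B))) as [H|H].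
    + exists (S B :: L). intros k. simpl. rewrite HL. split.
      * intros [<-|[Hk Tk]]; auto.
      * intros [Hk Tk]. destruct (Nat.eq_dec (S B) k); [now left|]. right. split; [lia|easy].
    + exists L. intros k. rewrite HL. split; intros [Hk Tk]; (split; [|easy]); [lia|].
      assert (k <> S B) by congruence. lia.
Qed.

(** The lower half realizes all of [T]; the upper half is a single band, adding only the count
    [2 * j + 1], already in [T]. At level 1/2, [K] is split into two end counts as in
    [arm_of_list]. *)
Lemma split_arm_bounded (T : nat -> Prop) j m K :
  (1 <= m <= j + 1)%nat -> (1 <= K <= 2 * j + 1)%nat -> T (2 * j + 1)%nat ->
  (forall k, T k -> 1 <= k <= 2 * j + 1)%nat -> exists f, split_arm f m K T.
Proof.
  intros Hm HK Tn HT. destruct (bounded_list T (2 * j + 1)) as (L & HL).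
  destruct (arm_of_list j L m (min K (j + 1))) as (f & Hf); [lia|lia| |].
  { intros k Hk. apply HT, HL, Hk. }
  destruct (band j (K + 1 - min K (j + 1)) m) as (g & Hg); [lia|lia|].
  exists (join f g). apply (split_arm_join _ _ _ _ _ _ _ _ _ Hf Hg); [lia|].
  intros k. rewrite HL. split.
  - intros Tk. left. right. split; [now apply HT|easy].
  - intros [[->|[_ Tk]]|<-]; easy.
Qed.

(** The lower half is a tower of bands, the upper half one band. No single band width bounds [T], so
    the widths vary with the step. *)
Lemma split_arm_unbounded (T : nat -> Prop) m K :
  (1 <= m)%nat -> (1 <= K)%nat -> (forall k, T k -> 1 <= k)%nat ->
  (forall B, exists j, (B <= j)%nat /\ T (2 * j + 1)%nat) -> exists f, split_arm f m K T.
Proof.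
  intros Hm HK HT Hinf. destruct (Hinf 0%nat) as (j0 & _ & T0).
  (* The junction between steps [i] and [i+1] of the tower realizes the count [i], if [T i]. *)
  assert (Hkap : forall i, exists k, T k /\ (T i -> k = i)).
  { intros i. destruct (classic (T i)) as [H|H]; [now exists i|].
    exists (2 * j0 + 1)%nat. split; [easy|]. tauto. }
  apply functional_choice in Hkap. destruct Hkap as (kap & Hkap).
  (* Step [i] has bottom count [p i] and top count 1, so the junction above it has count
     [1 + p (S i) - 1 = kap i]; the bottom of the whole tower has count [m]. *)
  set (p := fun i => match i with O => m | S i => kap i end).
  assert (Hp : forall i, (1 <= p i)%nat).
  { intros [|i]; [easy|]. apply HT, Hkap. }
  assert (Hst : forall i, exists s : (R -> R) * nat,
    T (2 * snd s + 1)%nat /\ arm (fst s) (p i) 1 (eq (2 * snd s + 1)%nat)).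
  { intros i. destruct (Hinf (p i)) as (j & Hj & Tj). pose proof (Hp i).
    destruct (band j (p i) 1) as (f & Hf); [lia|lia|]. now exists (f, j). }
  apply functional_choice in Hst. destruct Hst as (st & Hst).
  pose proof (arm_tower (fun i => fst (st i)) p (fun _ => 1%nat) _ (fun i => proj2 (Hst i))) as Hf.
  destruct (Hinf (m + K)%nat) as (j & Hj & Tj).
  (* The tower ends with count 1 at its top, so a band with bottom count [K] gives [1 + K - 1 = K]
     at level 1/2. *)
  destruct (band j K m) as (g & Hg); [lia|lia|].
  eexists. apply (split_arm_join _ _ _ _ _ _ _ _ _ Hf Hg); [lia|].
  intros k. split.
  - intros Tk. left. right. exists k. simpl. destruct (Hkap k) as [_ E]. rewrite (E Tk). lia.
  - intros [[[i <-]|[i E]]| <-]; [apply Hst| |easy].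
    simpl in E. replace k with (kap i) by lia. apply Hkap.
Qed.

(** * From arms to functions with a given set of counts *)

Lemma omega_of_cards f (S : nat -> Prop) :
  (forall x, exists n, S n /\ card f x n) -> (forall n, S n -> exists x, card f x n) ->
  Omega_eq f S.
Proof.
  intros H1 H2. split.
  - intros x. destruct (H1 x) as (n & _ & Hn). now exists n.
  - intros n. split; [apply H2|]. intros (x & Hx). destruct (H1 x) as (k & Sk & Hk).
    now rewrite (has_card_unique _ _ _ Hx Hk).
Qed.

Lemma unit_level_cases x :
  (x < 0 \/ 1 < x) \/ x = 0 \/ x = 1 \/ x = 1/2 \/ (0 < x < 1 /\ x <> 1/2).
Proof.
  destruct (Req_dec x 0), (Req_dec x 1), (Req_dec x (1/2)); auto 6.
  destruct (Rlt_or_le x 0); auto 6. destruct (Rlt_or_le 1 x); auto 6. right. right. right. right. lra.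
Qed.

Lemma realize_of_split_arm f (S : nat -> Prop) m K Q : split_arm f m K Q ->
  (forall n, S n <-> n = 0%nat \/ n = m \/ n = K \/ Q n) ->
  exists f, cont_on_01 f /\ Omega_eq f S.
Proof.
  intros ((C & F0 & F1 & Rg) & H0 & H1 & HK & H2 & H3) HS.
  assert (Hout : forall x, x < 0 \/ 1 < x -> card f x 0).
  { intros x Hx. apply card_avoid. intros t Ht. pose proof (Rg t Ht). lra. }
  exists f. split; [now apply continuity_cont_on_01|]. apply omega_of_cards.
  - intros x. destruct (unit_level_cases x) as [Hx|[->|[->|[->|[Hx N]]]]].
    + exists 0%nat. rewrite HS. auto.
    + exists m. rewrite HS. auto.
    + exists m. rewrite HS. auto.
    + exists K. rewrite HS. auto.
    + destruct (H2 x Hx N) as (k & Qk & Hk). exists k. rewrite HS. auto.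
  - intros n Sn. apply HS in Sn. destruct Sn as [->|[->|[->|Qn]]].
    + exists 2. apply Hout. lra.
    + now exists 0.
    + now exists (1/2).
    + destruct (H3 n Qn) as (x & _ & _ & Hx). now exists x.
Qed.

(* The path 1/2 -> 1 -> 0 -> 1/2 whose middle part is the reversed arm: every level other than
   0, 1/2 and 1 is met once more than by the arm, level 1/2 twice more. *)
Lemma realize_of_split_arm_loop f (S : nat -> Prop) m K Q : split_arm f m K Q ->
  (forall n, S n <-> n = 0%nat \/ n = m \/ n = (K + 2)%nat \/ exists k, Q k /\ n = (k + 1)%nat) ->
  exists f, cont_on_01 f /\ Omega_eq f S.
Proof.
  intros ((C & F0 & F1 & Rg) & H0 & H1 & HK & H2 & H3) HS.
  set (u := fun t : R => (1/2) * t + 1/2). set (d := fun t => f (1 - t)).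
  set (w := fun t : R => (1/2) * t + 0).
  assert (d0 : d 0 = 1) by (unfold d; now replace (1 - 0) with 1 by ring).
  assert (d1 : d 1 = 0) by (unfold d; now replace (1 - 1) with 0 by ring).
  assert (E1 : u 1 = d 0) by (unfold u; lra).
  assert (D1 : conc u d 1 = 0) by (now rewrite conc_1).
  assert (E2 : conc u d 1 = w 0) by (unfold w; lra).
  assert (U1 : u 1 = 1) by (unfold u; lra).
  assert (Cu : forall x, 1/2 <= x <= 1 -> card u x 1) by (intros; apply card_line; lra).
  assert (Cu' : forall x, x < 1/2 \/ 1 < x -> card u x 0).
  { intros x Hx. apply card_avoid. unfold u. intros t Ht. lra. }
  assert (Cw : forall x, 0 <= x <= 1/2 -> card w x 1) by (intros; apply card_line; lra).
  assert (Cw' : forall x, x < 0 \/ 1/2 < x -> card w x 0).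
  { intros x Hx. apply card_avoid. unfold w. intros t Ht. lra. }
  set (h := conc (conc u d) w).
  assert (G : forall x a b c, x <> 0 -> x <> 1 -> card u x a -> card f x b -> card w x c ->
    card h x (a + b + c)).
  { intros x a b c N0 N1 Ha Hb Hc. apply card_conc_ne; [easy|lra| |easy].
    apply card_conc_ne; [easy|lra|easy|]. now apply card_reverse. }
  assert (Hout : forall x, x < 0 \/ 1 < x -> card h x 0).
  { intros x Hx. apply (G x 0%nat 0%nat 0%nat); [lra|lra|apply Cu'; lra| |apply Cw'; lra].
    apply card_avoid. intros t Ht. pose proof (Rg t Ht). lra. }
  (* At level 0 the start of [w] is the end of [d], and at level 1 the end of [u] is the start of
     [d], so neither line adds a point there. *)
  assert (h0 : card h 0 m).
  { replace m with (0 + m + 1 - 1)%nat by lia.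
    apply card_conc_eq; [easy|lra| |apply Cw; lra].
    apply card_conc_ne; [easy|lra|apply Cu'; lra|]. now apply card_reverse. }
  assert (h1 : card h 1 m).
  { replace m with (1 + m - 1 + 0)%nat by lia.
    apply card_conc_ne; [easy|lra| |apply Cw'; lra].
    apply card_conc_eq; [easy|lra|apply Cu; lra|]. now apply card_reverse. }
  assert (hK : card h (1/2) (K + 2)).
  { replace (K + 2)%nat with (1 + K + 1)%nat by lia.
    apply G; [lra|lra|apply Cu; lra|easy|apply Cw; lra]. }
  assert (hQ : forall x k, 0 < x < 1 -> x <> 1/2 -> card f x k -> card h x (k + 1)).
  { intros x k Hx N Hk. destruct (Rlt_or_le x (1/2)).
    - replace (k + 1)%nat with (0 + k + 1)%nat by lia.
      apply G; [lra|lra|apply Cu'; lra|easy|apply Cw; lra].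
    - replace (k + 1)%nat with (1 + k + 0)%nat by lia.
      apply G; [lra|lra|apply Cu; lra|easy|apply Cw'; lra]. }
  exists h. split.
  { apply continuity_cont_on_01. apply continuity_conc; [|apply continuity_affine].
    apply continuity_conc; [apply continuity_affine|].
    apply (continuity_comp (fun t => 1 - t) f); [intros x; reg|easy]. }
  apply omega_of_cards.
  - intros x. destruct (unit_level_cases x) as [Hx|[->|[->|[->|[Hx N]]]]].
    + exists 0%nat. rewrite HS. auto.
    + exists m. rewrite HS. auto.
    + exists m. rewrite HS. auto.
    + exists (K + 2)%nat. rewrite HS. auto.
    + destruct (H2 x Hx N) as (k & Qk & Hk). exists (k + 1)%nat. rewrite HS.
      split; [|now apply hQ]. right. right. right. now exists k.
  - intros n Sn. apply HS in Sn. destruct Sn as [->|[->|[->|(k & Qk & ->)]]].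
    + exists 2. apply Hout. lra.
    + now exists 0.
    + now exists (1/2).
    + destruct (H3 k Qk) as (x & Hx & N & Hk). exists x. now apply hQ.
Qed.

(** The set {0, 1, 2} is treated apart: the loop has count [K + 2] at level 1/2, and its arm meets
    that level at least once, so it would produce a count of at least 3. *)
Lemma realize_tent (S : nat -> Prop) : (forall n, S n <-> (n <= 2)%nat) ->
  exists f, cont_on_01 f /\ Omega_eq f S.
Proof.
  intros HS. set (u := fun t : R => 1 * t + 0). set (d := fun t : R => (-1) * t + 1).
  assert (E : u 1 = d 0) by (unfold u, d; lra).
  assert (U1 : u 1 = 1) by (unfold u; lra).
  assert (Cu : forall x, 0 <= x <= 1 -> card u x 1) by (intros; apply card_line; lra).
  assert (Cd : forall x, 0 <= x <= 1 -> card d x 1).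
  { intros; apply card_line; [lra|]. lra. }
  assert (H2 : forall x, 0 <= x < 1 -> card (conc u d) x 2).
  { intros x Hx. apply (card_conc_ne u d x 1 1); [easy|lra|apply Cu; lra|apply Cd; lra]. }
  assert (H1 : card (conc u d) 1 1).
  { apply (card_conc_eq u d 1 1 1); [easy|lra|apply Cu; lra|apply Cd; lra]. }
  assert (H0 : forall x, x < 0 \/ 1 < x -> card (conc u d) x 0).
  { intros x Hx. apply (card_conc_ne u d x 0 0); [easy|lra| |];
      apply card_avoid; unfold u, d; intros; lra. }
  exists (conc u d). split.
  { apply continuity_cont_on_01, continuity_conc; apply continuity_affine. }
  apply omega_of_cards.
  - intros x. destruct (Rlt_or_le x 0); [exists 0%nat; rewrite HS; auto|].
    destruct (Rlt_or_le 1 x); [exists 0%nat; rewrite HS; auto|].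
    destruct (Req_dec x 1) as [->|]; [exists 1%nat; rewrite HS; auto|].
    exists 2%nat. rewrite HS. split; [easy|]. apply H2. lra.
  - intros n Sn. apply HS in Sn.
    assert (n = 0 \/ n = 1 \/ n = 2)%nat as [->|[->| ->]] by lia.
    + exists 2. apply H0. lra.
    + now exists 1.
    + exists 0. apply H2. lra.
Qed.

(** * Choice of the construction by boundedness and parity *)

Lemma unbounded_ge (S : nat -> Prop) : ~ nat_bounded S -> forall B, exists k, S k /\ (B <= k)%nat.
Proof.
  intros N B. apply NNPP. intros H. apply N. exists B. intros k Sk.
  destruct (Nat.le_gt_cases k B) as [|L]; [easy|]. exfalso. apply H. exists k. split; [easy|lia].
Qed.

Section Realization.
Variables (S : nat -> Prop) (m : nat).
Hypotheses (S0 : S 0%nat) (Hm : is_m1 S m).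

Lemma realize_odd K : S K ->
  (forall T, (forall k, T k <-> S k /\ k <> 0%nat) -> exists f, split_arm f m K T) ->
  exists f, cont_on_01 f /\ Omega_eq f S.
Proof.
  intros SK H. destruct (H (fun k => S k /\ k <> 0%nat)) as (f & Hf); [easy|].
  apply (realize_of_split_arm _ _ _ _ _ Hf). destruct Hm as (Sm & _ & _).
  intros n. split.
  - intros Sn. destruct (Nat.eq_dec n 0); auto.
  - intros [->|[->|[->|[Sn _]]]]; easy.
Qed.

(** The loop adds 1 to the counts of the arm, so the arm has to realize [S] shifted down by 1; even
    counts of [S] become the odd ones that bands provide. *)
Lemma realize_even K : S (K + 2)%nat ->
  (forall T, (forall k, T k <-> S (k + 1)%nat /\ k <> 0%nat) -> exists f, split_arm f m K T) ->
  exists f, cont_on_01 f /\ Omega_eq f S.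
Proof.
  intros SK H. destruct (H (fun k => S (k + 1)%nat /\ k <> 0%nat)) as (f & Hf); [easy|].
  apply (realize_of_split_arm_loop _ _ _ _ _ Hf). destruct Hm as (Sm & Nm & Hmin).
  intros n. split.
  - intros Sn. destruct (Nat.eq_dec n 0); [auto|]. destruct (Nat.eq_dec n m); [auto|].
    (* Here [n > m >= 1], so [n - 1] is nonzero. A count 1 in [S] would equal [m] and is already
       supplied by the extreme levels. *)
    pose proof (Hmin n Sn). right. right. right. exists (n - 1)%nat.
    replace (n - 1 + 1)%nat with n by lia. repeat split; [easy|lia].
  - intros [->|[->|[->|(k & [Sk _] & ->)]]]; easy.
Qed.

Lemma realize_bounded M : S M -> (forall k, S k -> (k <= M)%nat) -> (2 * m - 1 <= M)%nat ->
  exists f, cont_on_01 f /\ Omega_eq f S.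
Proof.
  intros SM HM L. destruct Hm as (Sm & Nm & Hmin).
  destruct (Nat.Even_or_Odd M) as [(j & E)|(j & E)].
  - destruct (Nat.eq_dec M 2) as [E2|N2].
    + apply realize_tent. intros n. split; [intros Sn; apply HM in Sn; lia|].
      (* From [2 * m - 1 <= 2]; hence 0, 1 and 2 all belong to [S]. *)
      intros Hn. assert (m = 1)%nat by lia. subst m.
      assert (n = 0 \/ n = 1 \/ n = 2)%nat as [->|[->| ->]] by lia; trivial. now rewrite <- E2.
    + apply (realize_even (M - 2)).
      { now replace (M - 2 + 2)%nat with M by lia. }
      (* With [M = 2 * j] the shifted maximum is [2 * (j - 1) + 1], and [2 * m - 1 <= 2 * j] gives
         the required [m <= j]. *)
      intros T HT. apply (split_arm_bounded T (j - 1)); [lia|lia| |].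
      * apply HT. replace (2 * (j - 1) + 1 + 1)%nat with M by lia. split; [easy|lia].
      * intros k Tk. apply HT in Tk. destruct Tk as [Sk Nk]. apply HM in Sk. lia.
  - apply (realize_odd M SM). intros T HT. apply (split_arm_bounded T j); [lia|lia| |].
    + apply HT. rewrite <- E. split; [easy|lia].
    + intros k Tk. apply HT in Tk. destruct Tk as [Sk Nk]. apply HM in Sk. lia.
Qed.

Lemma realize_unbounded : ~ nat_bounded S -> exists f, cont_on_01 f /\ Omega_eq f S.
Proof.
  intros N. destruct Hm as (Sm & Nm & Hmin).
  destruct (classic (nat_bounded (fun k => S k /\ Nat.Odd k))) as [(B & HB)|No].
  (* The bound 3 ensures that [K = s - 2] is at least 1. *)
  - destruct (unbounded_ge S N 3) as (s & Ss & Hs).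
    apply (realize_even (s - 2)).
    { now replace (s - 2 + 2)%nat with s by lia. }
    intros T HT. apply split_arm_unbounded; [lia|lia| |].
    + intros k Tk. apply HT in Tk. lia.
    (* An element of [S] beyond the bound [B] on its odd elements is even, and its shift by 1 is
       odd. *)
    + intros D. destruct (unbounded_ge S N (B + 2 * D + 2)%nat) as (k & Sk & Hk).
      destruct (Nat.Even_or_Odd k) as [(j & E)|O].
      * exists (j - 1)%nat. split; [lia|]. apply HT.
        replace (2 * (j - 1) + 1 + 1)%nat with k by lia. split; [easy|lia].
      * assert (k <= B)%nat by (apply HB; now split). lia.
  - apply (realize_odd m Sm). intros T HT. apply split_arm_unbounded; [lia|lia| |].
    + intros k Tk. apply HT in Tk. lia.
    + intros D. destruct (unbounded_ge _ No (2 * D + 1)%nat) as (k & [Sk (j & E)] & Hk).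
      exists j. split; [lia|]. apply HT. rewrite <- E. split; [easy|lia].
Qed.

End Realization.

Lemma m1_exists (S : nat -> Prop) k : S k -> k <> 0%nat -> exists m, is_m1 S m.
Proof.
  induction k as [k IH] using (well_founded_induction lt_wf). intros Sk Nk.
  destruct (classic (exists i, (i < k)%nat /\ S i /\ i <> 0%nat)) as [(i & L & Si & Ni)|N].
  - now apply (IH i).
  - exists k. split; [easy|]. split; [easy|]. intros i Si Ni.
    destruct (Nat.le_gt_cases k i); [easy|]. exfalso. apply N. now exists i.
Qed.

Theorem theorem1 (S : nat -> Prop) :
  S 0%nat ->
  (exists a b, S a /\ S b /\ a <> b) ->
  ((exists f : R -> R, cont_on_01 f /\ Omega_eq f S) <-> m2_ge S).
Proof.
  intros S0 (a & b & Sa & Sb & Nab). split.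
  - intros (f & Hf & Ho). now apply realizable_m2_ge with f.
  - intros H. assert (E : exists m, is_m1 S m).
    { destruct (Nat.eq_dec a 0) as [->|]; [apply (m1_exists S b)|apply (m1_exists S a)]; auto. }
    destruct E as (m & Hm). destruct (H m Hm) as [N|(M & SM & HM & L)].
    + now apply realize_unbounded with m.
    + now apply realize_bounded with m M.
Qed.
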